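(* Let $(\mathcal{H},|\cdot|)$ be a separable Hilbert space and let $f=(f_j)_{j=0}^{\infty}$ be an $\mathcal{H}$-valued martingale relative to a filtration $(\mathscr{F}_j)_{j=0}^{\infty}$ on a probability space $(\Omega,\mathscr{F},\mathbb{P})$. Suppose there is a nonnegative predictable sequence $w=(w_j)_{j=1}^{\infty}$ (i.e. $w_j$ is $\mathscr{F}_{j-1}$-measurable) such that $|f_j-f_{j-1}|\le w_j$ almost surely for every $j\in\mathbb{N}$. Then for every $b\ge \big\|\sum_{j=1}^{\infty}w_j^2\big\|_{\infty}$ and every $r>0$, $$\mathbb{P}\{f^*\ge r\}\le 2\exp\Big\{-\frac{r^2}{2b}\Big\},$$ where $f^*=\sup_{j\in\mathbb{N}}|f_j-f_0|$.
   Context: $\|\cdot\|_\infty$ denotes the $L^\infty(\mathbb{P})$-norm (essential supremum). Martingales are sequences of Bochner-integrable random variables adapted to the filtration with $\mathbb{E}(f_j\mid\mathscr{F}_s)=f_s$ for $s\le j$. Standing convention: $\mathscr{F}_0$ is the trivial $\sigma$-algebra. *)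

(* Defs.v *)
From HB Require Import structures.
From mathcomp Require Import all_boot all_order all_algebra.
From mathcomp Require Import all_classical all_reals all_analysis ess_sup_inf.
Set Implicit Arguments. Unset Strict Implicit. Unset Printing Implicit Defensive.
Import Order.TTheory GRing.Theory Num.Theory.
Import numFieldNormedType.Exports.
Local Open Scope classical_set_scope.
Local Open Scope ring_scope.

(* (V, ip) is a real inner-product space whose inner product induces the norm
   of V; together with completeness of V this makes V a real Hilbert space. *)
Definition is_inner_product {R : realType} {V : normedModType R}
  (ip : V -> V -> R) : Prop :=
  [/\ (forall x y, ip x y = ip y x),
      (forall (a : R) (x y z : V), ip (a *: x + y) z = a * ip x z + ip y z) &
      (forall x, ip x x = `|x| ^+ 2)].

Definition separable_space {R : realType} {V : normedModType R} : Prop :=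
  exists u : nat -> V, forall (x : V) (e : R), 0 < e ->
    exists k, `|x - u k| < e.

Definition G_measurable {d} {T : measurableType d} {R : realType}
  (G : set (set T)) (g : T -> R) : Prop :=
  forall B : set R, measurable B -> G (g @^-1` B).

(* a filtration (F_j)_{j>=0} of sub-sigma-algebras of the ambient one,
   with F_0 trivial (standing convention) *)
Definition filtration {d} {T : measurableType d}
  (F : nat -> set (set T)) : Prop :=
  [/\ (forall j, sigma_algebra setT (F j)),
      (forall j, F j `<=` measurable),
      (forall i j, (i <= j)%N -> F i `<=` F j) &
      F 0%N = [set set0; setT]].

(* f = (f_j) is an H-valued martingale w.r.t. F:
   - f_j is Bochner integrable: (weakly, hence strongly since H separable)
     measurable, with integrable norm;
   - f_j is F_j-measurable (adapted);
   - E(f_j | F_s) = f_s for s <= j, i.e. int_A f_j dP = int_A f_s dP for every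
     A in F_s (the equality of Bochner integrals in H being tested against
     every h in H). *)
Definition martingale {d} {T : measurableType d} {R : realType}
  {V : normedModType R} (ip : V -> V -> R) (P : probability T R)
  (F : nat -> set (set T)) (f : nat -> T -> V) : Prop :=
  [/\ (forall j, P.-integrable setT (fun x => (`|f j x|)%:E)),
      (forall j (h : V), G_measurable (F j) (fun x => ip (f j x) h)) &
      (forall s j, (s <= j)%N -> forall A, F s A -> forall h : V,
         (\int[P]_(x in A) (ip (f j x) h)%:E =
          \int[P]_(x in A) (ip (f s x) h)%:E)%E)].

(* Main.v *)
Require Import Defs.
From HB Require Import structures.
From mathcomp Require Import all_boot all_order all_algebra.
From mathcomp Require Import all_classical all_reals all_analysis ess_sup_inf.
From mathcomp Require Import measurable_realfun ring lra.
Set Implicit Arguments.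
Unset Strict Implicit.
Unset Printing Implicit Defensive.

Import Order.TTheory GRing.Theory Num.Theory.
Import numFieldNormedType.Exports.
Local Open Scope classical_set_scope.
Local Open Scope ring_scope.

(** Pinelis' exponential supermartingale, in Hoeffding form. If [|y| <= w] then
    [|x + y|^2 <= |x|^2 + w^2 + 2 <x, y>] with [|<x, y>| <= |x| w]. Since
    [cosh (sqrt s)] is convex and nondecreasing in [s], it lies below its chord
    between [s = (|x| - w)^2] and [s = (|x| + w)^2], which gives
      [cosh (l |x + y|) <= cosh (l |x|) cosh (l w) + K <x, y>]
    where [K] only depends on [|x|] and [w]. As [cosh (l w) <= exp (l^2 w^2 / 2)]
    and [w] is predictable, the process
      [cosh (l |f_j - f_0|) exp (- l^2 (w_1^2 + ... + w_j^2) / 2)]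
    is a supermartingale as long as [|f_j - f_0|] stays below a level [rho < r].
    Stopping it at the first exit above [rho] and taking [l = rho / b] bounds the
    exit probability by [2 exp (- rho^2 / (2 b))]; then let [rho] increase to [r].
    No conditional expectation of a vector is needed: the increment is tested
    against predictable vectors through approximation by countably valued ones. *)

(** * Hyperbolic cosine: power series, convexity in the square, Gaussian bound *)

Definition coshR {R : realType} (x : R) : R := (expR x + expR (- x)) / 2.

Definition sinhR {R : realType} (x : R) : R := (expR x - expR (- x)) / 2.

(* [sinhcR 0] is [0], not the limit [1]; in all uses it multiplies [0]. *)
Definition sinhcR {R : realType} (x : R) : R := sinhR x / x.

(** Indexed by all exponents, with zeros at the odd ones, so that partial sums line up with those of
    [exp_coeff x] and [exp_coeff (- x)]. *)
Definition coshR_coeff {R : realType} (x : R) (n : nat) : R :=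
  if odd n then 0 else x ^+ n / n`!%:R.

(** Compares the coefficient of x^(2n) in cosh x with that in exp(x^2 / 2). *)
Lemma exp2_fact_le n : (2 ^ n * n`! <= n.*2`!)%N.
Proof.
elim: n => // n ih; rewrite doubleS !factS expnS mulnACA mul2n doubleS.
by rewrite leq_mul// (leq_trans ih)// leq_pmull.
Qed.

Section Hyperbolic.
Context {R : realType}.
Implicit Types x y p w t u : R.

Lemma coshR0 : coshR (0 : R) = 1.
Proof. by rewrite /coshR oppr0 expR0; lra. Qed.

Lemma coshR_gt0 x : 0 < coshR x.
Proof. by rewrite divr_gt0// addr_gt0// expR_gt0. Qed.

Lemma coshR_ge_expR x : expR x / 2 <= coshR x.
Proof. by rewrite /coshR; have := expR_ge0 (- x); lra. Qed.

Lemma coshR_cvg x : series (coshR_coeff x) @ \oo --> coshR x.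
Proof.
have h := cvgM (cvgD (is_cvg_series_exp_coeff x)
  (is_cvg_series_exp_coeff (- x))) (cvg_cst (2^-1 : R)).
rewrite (_ : series (coshR_coeff x) = (series (exp_coeff x) \+
  series (exp_coeff (- x))) \* cst 2^-1); first exact: h.
apply/funext => n /=; rewrite !seriesEnat /= -big_split/= mulr_suml.
apply: eq_bigr => i _; rewrite /coshR_coeff /exp_coeff /= exprNn.
by rewrite -signr_odd; case: (odd i) => /=; rewrite ?expr0 ?expr1; field.
Qed.

Lemma ler_coshR_coeff (v : R) x :
  (forall n, series (coshR_coeff x) n <= v) -> coshR x <= v.
Proof.
move=> h; rewrite -(cvg_lim _ (@coshR_cvg x))//.
by apply: limr_le; [exact/cvgP/coshR_cvg|exact: nearW].
Qed.

Lemma coshR_coeff_ge0 x n : 0 <= coshR_coeff x n.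
Proof.
rewrite /coshR_coeff; case: ifPn => // en.
by rewrite divr_ge0// exprn_even_ge0.
Qed.

Lemma expr_mean_le (m a c : R) k : 0 <= m <= 1 -> 0 <= a -> 0 <= c ->
  ((1 - m) * a + m * c) ^+ k <= (1 - m) * a ^+ k + m * c ^+ k.
Proof.
move=> /andP[m0 m1] a0 c0; elim: k => [|k ih]; first by rewrite !expr0; lra.
rewrite exprS.
have s0 : 0 <= (1 - m) * a + m * c by rewrite addr_ge0// mulr_ge0//; lra.
apply: (le_trans (ler_wpM2l s0 ih)).
(* The two factors c - a and c^k - a^k have the same sign, since powers are monotone on nonnegative
   reals. *)
rewrite -subr_ge0 [leRHS](_ : _ = m * (1 - m) * ((c - a) * (c ^+ k - a ^+ k))).
  rewrite mulr_ge0//; first by rewrite mulr_ge0//; lra.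
  have [ac|/ltW ca] := leP a c.
    by rewrite mulr_ge0// subr_ge0// lerXn2r// ?nnegrE.
  by rewrite mulr_le0// subr_le0// lerXn2r// ?nnegrE.
by rewrite !exprS; ring.
Qed.

(* [coshR u] is a power series in [u ^+ 2] with nonnegative coefficients, hence
   a nondecreasing convex function of [u ^+ 2]. *)
Lemma coshR_convex_sqr (m a c u : R) : 0 <= m <= 1 ->
  u ^+ 2 <= (1 - m) * a ^+ 2 + m * c ^+ 2 ->
  coshR u <= (1 - m) * coshR a + m * coshR c.
Proof.
move=> m01 ule; apply: ler_coshR_coeff => n.
have hx x : series (coshR_coeff x) n <= coshR x.
  rewrite -(cvg_lim _ (@coshR_cvg x))//; apply: nondecreasing_cvgn_le.
    by apply: nondecreasing_series => i _ _; exact: coshR_coeff_ge0.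
  exact/cvgP/coshR_cvg.
case/andP: (m01) => m0 m1.
apply: (@le_trans _ _ ((1 - m) * series (coshR_coeff a) n +
    m * series (coshR_coeff c) n)); last first.
  by apply: lerD; apply: ler_wpM2l => //; lra.
rewrite !seriesEnat /= !mulr_sumr -big_split /=; apply: ler_sum => i _.
rewrite /coshR_coeff; case: ifPn => [_|ei]; first by rewrite !mulr0 addr0.
rewrite !mulrA -mulrDl ler_wpM2r// -(odd_double_half i) (negbTE ei) add0n.
rewrite -mul2n !exprM (le_trans _ (expr_mean_le _ _ _ _))// ?sqr_ge0//.
by rewrite lerXn2r// ?nnegrE ?sqr_ge0// (le_trans _ ule)// sqr_ge0.
Qed.

Lemma coshR_le_sqr p u : u ^+ 2 <= p ^+ 2 -> coshR u <= coshR p.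
Proof.
move=> up; have := @coshR_convex_sqr 0 p 0 u.
rewrite !subr0 !mul1r !mul0r !addr0; apply => //.
by rewrite lexx ler01.
Qed.

Lemma coshR_interpolate p w t u : 0 <= p -> 0 <= w -> `|t| <= p * w ->
  u ^+ 2 <= p ^+ 2 + w ^+ 2 + 2 * t ->
  coshR u <= coshR p * coshR w + t * (sinhcR p * sinhcR w).
Proof.
move=> p0 w0 tpw ule; have [pw0|pw0] := eqVneq (p * w) 0.
  have t0 : t = 0 by apply/eqP; rewrite -normr_le0 -pw0.
  move: ule; rewrite t0 mul0r mulr0 !addr0 => ule.
  move/eqP: pw0; rewrite mulf_eq0 => /orP[]/eqP z.
    by rewrite z coshR0 mul1r coshR_le_sqr// (le_trans ule)// z; lra.
  by rewrite z coshR0 mulr1 coshR_le_sqr// (le_trans ule)// z; lra.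
have [p'0 w'0] : p != 0 /\ w != 0 by move: pw0; rewrite mulf_eq0 => /norP.
have pwp : 0 < p * w by rewrite lt0r pw0 mulr_ge0.
have tle : -1 <= t / (p * w) <= 1.
  by move: tpw; rewrite ler_norml ler_pdivrMr// ler_pdivlMr// mul1r mulN1r.
(* This weight makes the mean of (p - w)^2 and (p + w)^2 equal to p^2 + w^2 + 2 t. As 2 m - 1 = t /
   (p w), the addition formulas for cosh (p - w) and cosh (p + w) then give the claimed right-hand
   side. *)
pose m := (1 + t / (p * w)) / 2.
have := @coshR_convex_sqr m (p - w) (p + w) u.
have -> : (1 - m) * (p - w) ^+ 2 + m * (p + w) ^+ 2 =
    p ^+ 2 + w ^+ 2 + 2 * t by rewrite /m; field; rewrite p'0 w'0.
move=> /(_ _ ule) h; apply: (le_trans (h _)); first by rewrite /m; lra.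
rewrite le_eqVlt; apply/orP; left; apply/eqP.
rewrite /sinhcR /coshR /sinhR !opprB !opprD !expRD /m.
by field; rewrite p'0 w'0.
Qed.

(** Termwise comparison of power series: 1 / (2n)! <= 1 / (2^n n!). *)
Lemma coshR_le_expR_sqr x : coshR x <= expR (x ^+ 2 / 2).
Proof.
apply: ler_coshR_coeff => n.
(* With 2n terms, each even term and the zero odd term after it are matched with one term of the
   series of exp(x^2 / 2). *)
apply: (@le_trans _ _ (series (coshR_coeff x) n.*2)).
  apply: nondecreasing_series => [i _ _|]; first exact: coshR_coeff_ge0.
  by rewrite -addnn leq_addr.
apply: (@le_trans _ _ (series (exp_coeff (x ^+ 2 / 2)) n)); last first.
  have c : cvgn (series (exp_coeff (x ^+ 2 / 2))).
    exact: is_cvg_series_exp_coeff.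
  rewrite /expR; apply: nondecreasing_cvgn_le => //.
  apply: nondecreasing_series => i _ _.
  by rewrite exp_coeff_ge0// divr_ge0// sqr_ge0.
rewrite !seriesEnat /=; elim: n => [|n ih]; first by rewrite !big_geq.
rewrite doubleS !big_nat_recr//= -addrA lerD//.
rewrite /coshR_coeff /= odd_double /= addr0 /exp_coeff /= expr_div_n -exprM.
rewrite mul2n -mulrA ler_wpM2l ?exprn_even_ge0 ?odd_double//.
rewrite -invfM lef_pV2 ?posrE; last 2 first.
- by rewrite ltr0n fact_gt0.
- by rewrite mulr_gt0 ?exprn_gt0 ?ltr0n ?fact_gt0.
by rewrite -natrX -natrM ler_nat exp2_fact_le.
Qed.

(** From 1 - y <= exp(- y) come both exp y - 1 <= y exp y and 1 - exp(- y) <= y; add them. *)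
Lemma sinhR_le y : 0 <= y -> sinhR y <= y * expR y.
Proof.
move=> y0; rewrite /sinhR.
have h1 : 1 - y <= expR (- y) by exact: expR_ge1Dx.
have h2 : expR y * expR (- y) = 1 by rewrite expRN mulfV// gt_eqF// expR_gt0.
have := expR_gt0 y; have : 1 <= expR y by rewrite -expR0 ler_expR.
nra.
Qed.

Lemma sinhR_ge0 y : 0 <= y -> 0 <= sinhR y.
Proof. by move=> y0; rewrite divr_ge0// subr_ge0 ler_expR; lra. Qed.

End Hyperbolic.

(** * Inner product: Cauchy-Schwarz, the pointwise cosh bound, weak measurability of the norm *)

Section InnerProduct.
Context {R : realType} {V : normedModType R}.
Variable ip : V -> V -> R.
Hypothesis ipP : is_inner_product ip.
Implicit Types x y z : V.

Lemma ip_sym x y : ip x y = ip y x.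
Proof. by case: ipP. Qed.

Lemma ip_norm x : ip x x = `|x| ^+ 2.
Proof. by case: ipP. Qed.

Lemma ipDl x y z : ip (x + y) z = ip x z + ip y z.
Proof. by case: ipP => _ h _; have := h 1 x y z; rewrite scale1r mul1r. Qed.

Lemma ip0l z : ip 0 z = 0.
Proof. by have := ipDl 0 0 z; rewrite addr0; lra. Qed.

Lemma ipZl (a : R) x z : ip (a *: x) z = a * ip x z.
Proof. by case: ipP => _ h _; have := h a x 0 z; rewrite ip0l !addr0. Qed.

Lemma ipBl x y z : ip (x - y) z = ip x z - ip y z.
Proof. by rewrite ipDl -scaleN1r ipZl mulN1r. Qed.

Lemma ipDr x y z : ip z (x + y) = ip z x + ip z y.
Proof. by rewrite ip_sym ipDl !(ip_sym z). Qed.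

Lemma ipBr x y z : ip z (x - y) = ip z x - ip z y.
Proof. by rewrite ip_sym ipBl !(ip_sym z). Qed.

Lemma ipZr (a : R) x z : ip z (a *: x) = a * ip z x.
Proof. by rewrite ip_sym ipZl ip_sym. Qed.

Lemma ip_normD x y : `|x + y| ^+ 2 = `|x| ^+ 2 + `|y| ^+ 2 + 2 * ip x y.
Proof. by rewrite -!ip_norm !(ipDl, ipDr) (ip_sym y x); lra. Qed.

Lemma ip_cauchy_schwarz x y : `|ip x y| <= `|x| * `|y|.
Proof.
rewrite -ler_sqr ?nnegrE ?mulr_ge0// -normrX.
rewrite ger0_norm ?sqr_ge0// exprMn.
have [->|y0] := eqVneq y 0.
  by rewrite ip_sym ip0l normr0 expr0n/= mulr0.
have yp : 0 < `|y| ^+ 2 by rewrite exprn_gt0// normr_gt0.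
(* The vector is |y|^2 times the component of x orthogonal to y; its squared norm is |y|^2 (|x|^2
   |y|^2 - <x, y>^2). *)
have : 0 <= `|(`|y| ^+ 2) *: x - ip x y *: y| ^+ 2 by exact: sqr_ge0.
rewrite -!ip_norm !(ipBl, ipBr, ipZl, ipZr) (ip_sym y x) !ip_norm.
set n := `|y| ^+ 2 in yp *; set m := `|x| ^+ 2; set p := ip x y.
rewrite (_ : _ - _ = n * (m * n - p ^+ 2)); last by ring.
by rewrite pmulr_rge0// subr_ge0.
Qed.

(** Interpolation with p = l |x| and t = l^2 <x, y>. The coefficient of [ip x y] involves only |x|
    and w, hence is predictable when y is a martingale increment. *)
Lemma coshR_norm_add (l w : R) x y : 0 <= l -> `|y| <= w ->
  coshR (l * `|x + y|) <= coshR (l * `|x|) * coshR (l * w) +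
    l ^+ 2 * (sinhcR (l * `|x|) * sinhcR (l * w)) *
    ip x y.
Proof.
move=> l0 yw; have w0 : 0 <= w by exact: le_trans yw.
rewrite [X in _ <= _ + X]mulrAC.
apply: coshR_interpolate; rewrite ?mulr_ge0//.
  rewrite normrM ger0_norm ?sqr_ge0// mulrACA -expr2 ler_wpM2l ?sqr_ge0//.
  by rewrite (le_trans (ip_cauchy_schwarz _ _))// ler_wpM2l.
rewrite !exprMn ip_normD [2 * (_ * _)]mulrCA -!mulrDr ler_wpM2l ?sqr_ge0//.
by rewrite lerD2r lerD2l lerXn2r// ?nnegrE.
Qed.

(** Turns a bound on the norm into countably many linear conditions, which is what measurability
    requires. For the converse, test against some u k close to x itself. *)
Lemma norm_le_dense (u : nat -> V) (a : R) x :
  (forall y (e : R), 0 < e -> exists k, `|y - u k| < e) -> 0 <= a ->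
  `|x| <= a <-> forall k, ip x (u k) <= a * `|u k|.
Proof.
move=> du a0; split=> [xa k|h].
  by rewrite (le_trans (ler_norm _))// (le_trans (ip_cauchy_schwarz _ _))//
    ler_wpM2r.
have [->|x0] := eqVneq x 0; first by rewrite normr0.
have xp : 0 < `|x| by rewrite normr_gt0.
rewrite -(ler_pM2l xp) -expr2 -ip_norm; apply/ler_addgt0Pr => e e0.
have c0 : 0 < a + `|x| by rewrite ltr_wpDl.
(* Replacing x by u k costs |x| |x - u k| in the inner product and at most a |x - u k| in the bound
   a |u k|, hence this tolerance. *)
have [k kd] := du x (e / (a + `|x|)) (divr_gt0 e0 c0).
have -> : ip x x = ip x (u k) + ip x (x - u k) by rewrite ipBr; lra.
have h1 := h k.
have h2 := le_trans (ler_norm _) (ip_cauchy_schwarz x (x - u k)).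
have h3 : `|u k| <= `|x| + `|x - u k|.
  by rewrite -{1}(subKr x (u k)) (le_trans (ler_normB _ _)).
have h4 : (a + `|x|) * `|x - u k| <= e.
  by rewrite mulrC -ler_pdivlMr// ltW.
nra.
Qed.

(** For a >= 0 the event |X| > a is a countable union of events on which one linear functional
    exceeds a level; for a < 0 it is the whole space. *)
Lemma measurable_norm_weak d (T : measurableType d) (X : T -> V) :
  @separable_space R V ->
  (forall h, measurable_fun setT (fun t => ip (X t) h)) ->
  measurable_fun setT (fun t => `|X t|).
Proof.
move=> [u du] mX.
apply: (measurability _ (RGenOInfty.measurableE R)).
move=> _ [_ [a ->] <-]; rewrite setTI.
have [a0|a0] := ltP a 0.
  rewrite (_ : _ @^-1` _ = setT)//; apply/seteqP; split=> // t _ /=.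
  by rewrite in_itv /= andbT (lt_le_trans a0).
rewrite (_ : _ @^-1` _ =
    \bigcup_k ((fun t => ip (X t) (u k)) @^-1` `]a * `|u k|, +oo[%classic)).
  apply: bigcup_measurable => k _; rewrite -[X in measurable X]setTI.
  exact: mX.
apply/seteqP; split=> t /=; rewrite in_itv /= andbT.
  rewrite ltNge => /negP h; apply: contrapT => h'; apply: h.
  apply/(norm_le_dense _ du a0) => k; rewrite leNgt; apply/negP => hk.
  by apply: h'; exists k => //=; rewrite in_itv /= andbT.
move=> [k _] /=; rewrite in_itv /= andbT => hk.
rewrite ltNge; apply/negP => /(norm_le_dense _ du a0)/(_ k).
by rewrite leNgt hk.
Qed.

End InnerProduct.

(** * Measurability with respect to a sub-sigma-algebra *)

(** Viewing [G] as the measurable structure of a type makes the closure properties of measurable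
    functions available for [G_measurable]. *)
Lemma G_measurableP d (T : measurableType d) (R : realType) (G : set (set T))
    (g : T -> R) : sigma_algebra setT G ->
  G_measurable G g <->
  measurable_fun [set: g_sigma_algebraType G] (g : g_sigma_algebraType G -> R).
Proof.
move=> sG; have E := measurable_g_measurableTypeE sG; split=> [mg _ B mB|mg B mB].
  by rewrite setTI E; exact: mg.
by rewrite -E -[X in measurable X]setTI; exact: mg.
Qed.

Lemma sub_sigma_measurable_fun d (T : measurableType d) (R : realType)
    (G : set (set T)) (g : T -> R) :
  G `<=` measurable -> G_measurable G g -> measurable_fun setT g.
Proof. by move=> GT mg _ B mB; rewrite setTI; exact/GT/mg. Qed.

(** * Orthogonality of a centred increment to predictable bounded vectors *)

Section Orthogonality.
Context {R : realType} {V : normedModType R}.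
Variable ip : V -> V -> R.
Hypothesis ipP : is_inner_product ip.
Hypothesis sepV : @separable_space R V.

(** Polarization reduces the pairing to norms, which are measurable by separability. *)
Lemma measurable_ip d (T : measurableType d) (X Y : T -> V) :
  (forall h, measurable_fun setT (fun t => ip (X t) h)) ->
  (forall h, measurable_fun setT (fun t => ip (Y t) h)) ->
  measurable_fun setT (fun t => ip (X t) (Y t)).
Proof.
move=> mX mY.
rewrite (_ : (fun _ => _) = fun t => 2^-1 *
    (`|X t + Y t| ^+ 2 - (`|X t| ^+ 2 + `|Y t| ^+ 2))); last first.
  by apply/funext => t; rewrite (ip_normD ipP); lra.
apply: measurable_funM => //; apply: measurable_funB; last apply: measurable_funD.
- apply: measurable_funX; apply: (measurable_norm_weak ipP sepV) => h.
  under eq_fun do rewrite (ipDl ipP).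
  exact: measurable_funD.
- by apply: measurable_funX; exact: (measurable_norm_weak ipP sepV).
- by apply: measurable_funX; exact: (measurable_norm_weak ipP sepV).
Qed.

Section TestFunctions.
Context d {T : measurableType d} (P : {finite_measure set T -> \bar R}).
Variables (G : set (set T)) (Y : T -> V) (A : set T).
Hypotheses (sG : sigma_algebra setT G) (GT : G `<=` measurable) (GA : G A).
Hypothesis mY : forall h, measurable_fun setT (fun t => ip (Y t) h).
Hypothesis iY : P.-integrable setT (fun t => `|Y t|%:E).
Hypothesis Y0 : forall B h, G B -> (\int[P]_(t in B) (ip (Y t) h)%:E = 0)%E.

Let mA : measurable A. Proof. exact: GT. Qed.

Lemma integrable_ip (X : T -> V) (M : R) :
  (forall h, G_measurable G (fun t => ip (X t) h)) ->
  (forall t, A t -> `|X t| <= M) ->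
  P.-integrable A (fun t => (ip (X t) (Y t))%:E).
Proof.
move=> mX XM; apply: (@le_integrable _ _ _ P A mA _ (fun t => M%:E * `|Y t|%:E)%E).
- apply/measurable_EFinP; apply: measurable_funTS; apply: measurable_ip => // h.
  exact: sub_sigma_measurable_fun (mX h).
- move=> t At; rewrite -EFinM lee_fin; have M0 := le_trans (normr_ge0 _) (XM t At).
  rewrite [leRHS]ger0_norm ?mulr_ge0// (le_trans (ip_cauchy_schwarz ipP _ _))//.
  by rewrite ler_wpM2r// XM.
- by apply: integrableZl => //; exact: integrableS iY.
Qed.

(* On the cells of a countable partition into sets of [G] on which [X] is within
   [e] of a vector [u k], the pairing with [Y] only sees [X - u k]. *)
Lemma integral_ip_le0 (X : T -> V) (M : R) :
  (forall h, G_measurable G (fun t => ip (X t) h)) ->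
  (forall t, A t -> `|X t| <= M) ->
  (\int[P]_(t in A) (ip (X t) (Y t))%:E <= 0)%E.
Proof.
move=> mX XM; have iXY := integrable_ip mX XM.
have iYA : P.-integrable A (fun t => `|Y t|%:E) by exact: integrableS iY.
case: (sepV) => u du.
have key (e : R) : 0 < e ->
    (\int[P]_(t in A) (ip (X t) (Y t))%:E <=
     e%:E * \int[P]_(t in A) (`|Y t|)%:E)%E.
  move=> e0.
  have ieY : P.-integrable A (fun t => e%:E * (`|Y t|)%:E)%E.
    exact: integrableZl.
  rewrite -integralZl// -sube_ge0; last by rewrite integrable_fin_num.
  rewrite -integralB//.
  (* The balls around the dense points cover the space, and [seqDU] makes them disjoint.
     Measurability is taken in [G], since [Y0] only applies to cells in [G]. *)
  pose B k : set (g_sigma_algebraType G) := [set t | `|X t - u k| < e].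
  pose C k : set (g_sigma_algebraType G) := A `&` seqDU B k.
  have mB k : measurable (B k).
    rewrite (_ : B k = (fun t => `|X t - u k|) @^-1` `]-oo, e[%classic).
      rewrite -[X in measurable X]setTI.
      apply: (@measurable_norm_weak _ _ _ ipP _ (g_sigma_algebraType G)) => // h.
      under eq_fun do rewrite (ipBl ipP).
      by apply: measurable_funB => //; exact/G_measurableP.
    by apply/seteqP; split=> t /=; rewrite in_itv.
  have GC k : G (C k).
    rewrite -(measurable_g_measurableTypeE sG); apply: measurableI.
      by rewrite (measurable_g_measurableTypeE sG).
    exact: seqDU_measurable.
  have CA k : C k `<=` A by exact: subIsetl.
  have AC : A = \bigcup_k C k.
    rewrite /C -setI_bigcupr -seqDU_bigcup_eq; apply/seteqP; split=> [t At|t []//].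
    split=> //; have [k kd] := du (X t) e e0; by exists k.
  rewrite AC integral_bigcup//; last 3 first.
  - move=> i j _ _ [t [[_ ti] [_ tj]]].
    by apply: (@trivIset_seqDU _ B) => //; exists t.
  - by move=> k; exact: GT.
  - by rewrite -AC; exact: integrableB.
  apply: nneseries_ge0 => k _ _.
  have mC : measurable (C k : set T) by exact: GT.
  have iu : P.-integrable (C k) (fun t => (ip (Y t) (u k))%:E).
    apply: (@le_integrable _ _ _ P _ mC _ (fun t => `|u k|%:E * `|Y t|%:E)%E).
    - by apply/measurable_EFinP; exact: measurable_funTS.
    - move=> t _; rewrite -EFinM lee_fin [leRHS]ger0_norm// mulrC.
      exact: ip_cauchy_schwarz.
    - by apply: integrableZl => //; exact: integrableS iY.
  have iHu : P.-integrable (C k)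
      (fun t => (e%:E * `|Y t|%:E - (ip (X t) (Y t))%:E)%E).
    apply: (@integrableS _ _ _ P A) => //; exact: integrableB.
  (* Adding the vanishing integral of <Y, u k> over the cell turns the integrand into e |Y| - <X - u
     k, Y>, which is nonnegative there. *)
  rewrite -[leRHS]adde0 -[X in (_ <= _ + X)%E](Y0 (u k) (GC k)) -integralD//=.
  apply: integral_ge0 => t [At [tB _]].
  rewrite -EFinM -EFinB -EFinD lee_fin (ip_sym ipP (Y t)).
  have -> : e * `|Y t| - ip (X t) (Y t) + ip (u k) (Y t) =
     e * `|Y t| - ip (X t - u k) (Y t) by rewrite (ipBl ipP); lra.
  rewrite subr_ge0 (le_trans (ler_norm _))// (le_trans (ip_cauchy_schwarz ipP _ _))//.
  by rewrite ler_wpM2r// ltW.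
have fY := integrable_fin_num mA iYA.
have := integrable_fin_num mA iXY; move: key.
case: (integral _ _ _) => // a key _; rewrite lee_fin; apply/ler_addgt0Pl => e e0.
have Y0' : (0 <= \int[P]_(t in A) (`|Y t|)%:E)%E by exact: integral_ge0.
move: fY Y0' key; case: (\int[P]_(t in A) (`|Y t|)%:E)%E => // y _.
rewrite lee_fin => y0 key.
(* The shift by 1 covers the case where the integral y of |Y| is zero. *)
have y1 : 0 < y + 1 by rewrite ltr_wpDl.
have := key (e / (y + 1)) (divr_gt0 e0 y1); rewrite lee_fin addr0 => /le_trans; apply.
by rewrite mulrAC ler_pdivrMr// ler_pM2l// lerDl.
Qed.

(** The one-sided bound is applied to X and to -X. *)
Lemma integral_ip_eq0 (X : T -> V) (M : R) :
  (forall h, G_measurable G (fun t => ip (X t) h)) ->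
  (forall t, A t -> `|X t| <= M) ->
  (\int[P]_(t in A) (ip (X t) (Y t))%:E = 0)%E.
Proof.
move=> mX XM; apply/eqP; rewrite eq_le (integral_ip_le0 mX XM)/=.
have := @integral_ip_le0 (fun t => (-1) *: X t) M.
under [in X in (X <= 0)%E]eq_integral do rewrite (ipZl ipP) EFinM.
rewrite integralZl//; last exact: integrable_ip mX XM.
rewrite EFinN mulN1e oppe_le0; apply.
  move=> h; apply/G_measurableP => //.
  under eq_fun do rewrite (ipZl ipP).
  by apply: measurable_funM => //; exact/G_measurableP.
by move=> t At; rewrite scaleN1r normrN XM.
Qed.

End TestFunctions.
End Orthogonality.

(** * Measurability and size of the hyperbolic coefficients *)

Lemma measurable_invr (R : realType) : measurable_fun [set: R] (@GRing.inv R).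
Proof.
rewrite (_ : @GRing.inv R = fun x => if x == 0 then 0 else x^-1); last first.
  by apply/funext => x; case: eqP => [->|//]; rewrite invr0.
apply: measurable_fun_if => //; first exact: measurable_fun_eqr.
rewrite setTI; rewrite (_ : _ @^-1` _ = [set x : R | x != 0]); last first.
  by apply/seteqP; split=> x /=; case: (x == 0).
apply: open_continuous_measurable_fun; first exact: open_neq.
by move=> x; rewrite inE => x0; exact: inv_continuous.
Qed.

Lemma measurable_coshR (R : realType) : measurable_fun [set: R] (@coshR R).
Proof.
apply: measurable_funM => //; apply: measurable_funD => //.
exact: measurableT_comp.
Qed.

Lemma measurable_sinhcR (R : realType) : measurable_fun [set: R] (@sinhcR R).
Proof.
apply: measurable_funM; last exact: measurable_invr.
apply: measurable_funM => //; apply: measurable_funB => //.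
exact: measurableT_comp.
Qed.

(** A crude bound suffices: it only serves to make the test vectors of the one-step estimate
    bounded. *)
Lemma sinhcR_le (R : realType) (y : R) :
  0 <= y -> 0 <= sinhcR y <= expR y.
Proof.
move=> y0; apply/andP; split; first by rewrite divr_ge0// sinhR_ge0.
have [->|yn0] := eqVneq y 0; first by rewrite /sinhcR invr0 mulr0 expR_ge0.
have yp : 0 < y by rewrite lt0r yn0.
by rewrite ler_pdivrMr// mulrC sinhR_le.
Qed.

(** * One step of the exponential supermartingale *)

Section OneStep.
Context {R : realType} {V : normedModType R}.
Variable ip : V -> V -> R.
Hypothesis ipP : is_inner_product ip.
Hypothesis sepV : @separable_space R V.
Context d {T : measurableType d} (P : {finite_measure set T -> \bar R}).
Variables (G : set (set T)) (g Y : T -> V) (E v : T -> R) (A : set T).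
Variables l rho c : R.
Hypotheses (sG : sigma_algebra setT G) (GT : G `<=` measurable) (GA : G A).
Hypothesis mY : forall h, measurable_fun setT (fun t => ip (Y t) h).
Hypothesis iY : P.-integrable setT (fun t => `|Y t|%:E).
Hypothesis Y0 : forall B h, G B -> (\int[P]_(t in B) (ip (Y t) h)%:E = 0)%E.
Hypothesis mg : forall h, G_measurable G (fun t => ip (g t) h).
Hypothesis g_le : forall t, A t -> `|g t| <= rho.
Hypotheses (mE : G_measurable G E) (E01 : forall t, 0 <= E t <= 1).
Hypotheses (mv : G_measurable G v) (v0c : forall t, 0 <= v t <= c).
Hypothesis Yv : {ae P, forall t, `|Y t| <= v t}.
Hypothesis l0 : 0 <= l.

(** Here [g] is the current position, [Y] the next increment, [v] its predictable bound and [E] the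
    discount accumulated so far. The pointwise cosh bound is integrated over [A], where its linear
    term vanishes. *)
Lemma integral_coshR_step :
  (\int[P]_(t in A)
     (coshR (l * `|g t + Y t|) * (E t * expR (- ((l * v t) ^+ 2 / 2))))%:E <=
   \int[P]_(t in A) (coshR (l * `|g t|) * E t)%:E)%E.
Proof.
have mA : measurable A by exact: GT.
pose e t := expR (- ((l * v t) ^+ 2 / 2)).
have e01 t : 0 <= e t <= 1.
  by rewrite expR_ge0/= -expR0 ler_expR oppr_le0 divr_ge0// sqr_ge0.
(* The discounted coefficient of <g, Y> in the cosh bound; absorbed into the vector [X], it gives a
   [G]-measurable test vector bounded on [A]. *)
pose s t := E t * e t * l ^+ 2 *
  (sinhcR (l * `|g t|) * sinhcR (l * v t)).
pose X t := s t *: g t.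
pose S := g_sigma_algebraType G.
have mgS h : measurable_fun [set: S] (fun t : S => ip (g t) h).
  exact/G_measurableP.
have mES : measurable_fun [set: S] (E : S -> R) by exact/G_measurableP.
have mvS : measurable_fun [set: S] (v : S -> R) by exact/G_measurableP.
have mngS : measurable_fun [set: S] (fun t : S => `|g t|).
  exact: (measurable_norm_weak ipP sepV).
have meS : measurable_fun [set: S] (e : S -> R).
  apply: measurableT_comp => //; apply: measurable_funN.
  apply: measurable_funM => //; apply: measurable_funX.
  exact: measurable_funM.
have msS : measurable_fun [set: S] (s : S -> R).
  apply: measurable_funM.
    by apply: measurable_funM => //; exact: measurable_funM.
  apply: measurable_funM;
    (apply: measurableT_comp; [exact: measurable_sinhcR|exact: measurable_funM]).
have mX h : G_measurable G (fun t => ip (X t) h).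
  apply/G_measurableP => //; under eq_fun do rewrite (ipZl ipP).
  exact: measurable_funM.
have XM t : A t -> `|X t| <= l ^+ 2 * (expR (l * rho) * expR (l * c)) * rho.
  move=> At; rewrite normrZ.
  have /andP[E0 E1] := E01 t; have /andP[e0 e1] := e01 t.
  have /andP[v0 vc] := v0c t; have gr := g_le At.
  have /andP[a0 a1] := sinhcR_le (mulr_ge0 l0 (normr_ge0 (g t))).
  have /andP[b0 b1] := sinhcR_le (mulr_ge0 l0 v0).
  apply: ler_pM => //.
  have E2 : 0 <= E t * e t * l ^+ 2 by exact: mulr_ge0 (mulr_ge0 E0 e0) (sqr_ge0 _).
  rewrite ger0_norm; last exact: mulr_ge0 E2 (mulr_ge0 a0 b0).
  apply: ler_pM; [exact: E2|exact: mulr_ge0| |].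
    by rewrite ler_piMl ?sqr_ge0// mulr_ile1.
  apply: ler_pM => //.
    by rewrite (le_trans a1)// ler_expR ler_wpM2l.
  by rewrite (le_trans b1)// ler_expR ler_wpM2l.
have iX := integrable_ip ipP sepV GT GA mY iY mX XM.
have X0 := integral_ip_eq0 ipP sepV sG GT GA mY iY Y0 mX XM.
have mT (h : T -> R) : measurable_fun [set: S] (h : S -> R) ->
    measurable_fun A h.
  move=> mh; apply: measurable_funTS; apply: sub_sigma_measurable_fun GT _.
  exact/G_measurableP.
have mcE : measurable_fun A (fun t => coshR (l * `|g t|) * E t).
  apply: mT; apply: measurable_funM => //.
  apply: measurableT_comp; first exact: measurable_coshR.
  exact: measurable_funM.
have icE : P.-integrable A (fun t => (coshR (l * `|g t|) * E t)%:E).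
  apply: (@le_integrable _ _ _ P A mA _ (EFin \o cst (coshR (l * rho)))).
  - exact/measurable_EFinP.
  - move=> t At; have /andP[E0 E1] := E01 t.
    rewrite lee_fin !ger0_norm ?mulr_ge0// ?(ltW (coshR_gt0 _))//.
    rewrite -[leRHS]mulr1 ler_pM ?(ltW (coshR_gt0 _))// coshR_le_sqr//.
    by rewrite lerXn2r// ?nnegrE ?mulr_ge0// ?(le_trans _ (g_le At))// ler_wpM2l// g_le.
  - exact: finite_measure_integrable_cst.
rewrite -[leRHS]adde0 -X0 -integralD//=.
pose H t := coshR (l * `|g t|) * E t + ip (X t) (Y t).
rewrite -/(H _).
have mH : measurable_fun A H.
  apply: measurable_funD => //.
  by apply/measurable_EFinP; exact: measurable_int iX.
have le_H : {ae P, forall t, A t ->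
    coshR (l * `|g t + Y t|) * (E t * e t) <= H t}.
  apply: filterS Yv => t Yt _.
  have /andP[E0 E1] := E01 t.
  have := coshR_norm_add ipP (g t) l0 Yt.
  have Ee0 : 0 <= E t * e t by rewrite mulr_ge0// expR_ge0.
  move=> /(ler_wpM2r Ee0)/le_trans; apply.
  rewrite mulrDl /H (ipZl ipP) /s lerD//.
    (* The new discount factor [e t] absorbs cosh(l v) because cosh(l v) <= exp((l v)^2 / 2). *)
    rewrite -[leLHS]mulrA ler_wpM2l ?(ltW (coshR_gt0 _))//.
    rewrite mulrCA ler_piMr// /e expRN ler_pdivrMr ?expR_gt0// mul1r.
    exact: coshR_le_expR_sqr.
  by rewrite le_eqVlt; apply/orP; left; apply/eqP; ring.
(* [H] is nonnegative only almost everywhere, while the comparison of integrals asks for it on all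
   of [A]; its positive part has the same integral. *)
apply: (@le_trans _ _ (\int[P]_(t in A) (Num.max 0 (H t))%:E)%E).
  apply: ae_ge0_le_integral => //.
  - move=> t At; rewrite lee_fin !mulr_ge0 ?expR_ge0 ?(ltW (coshR_gt0 _))//.
    by have /andP[] := E01 t.
  - apply/measurable_EFinP; apply: measurable_funM.
      apply: measurable_funTS; apply: measurableT_comp; first exact: measurable_coshR.
      apply: measurable_funM => //; apply: (measurable_norm_weak ipP sepV) => h.
      under eq_fun do rewrite (ipDl ipP).
      apply: measurable_funD => //; exact: sub_sigma_measurable_fun (mg h).
    by apply: measurable_funM; exact: mT.
  - by move=> t At; rewrite lee_fin le_max lexx.
  - by apply/measurable_EFinP; exact: measurable_maxr.
  - apply: filterS le_H => t h At; rewrite lee_fin le_max.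
    by apply/orP; right; exact: h.
rewrite (@ae_eq_integral _ _ _ P A (EFin \o H))//.
- by apply/measurable_EFinP; exact: measurable_maxr.
- exact/measurable_EFinP.
- apply: filterS le_H => t h At /=; congr EFin; apply/max_idPr.
  apply: le_trans (h At).
  rewrite !mulr_ge0 ?expR_ge0 ?(ltW (coshR_gt0 _))//.
  by have /andP[] := E01 t.
Qed.

End OneStep.

(** * Exit probabilities of the martingale from a ball *)

Section MaximalInequality.
Context {R : realType} {V : normedModType R}.
Variable ip : V -> V -> R.
Hypothesis ipP : is_inner_product ip.
Hypothesis sepV : @separable_space R V.
Context d {T : measurableType d} (P : probability T R).
Variables (F : nat -> set (set T)) (f : nat -> T -> V) (w : nat -> T -> R).
Variable b : R.
Hypothesis filtF : filtration F.
Hypothesis martf : martingale ip P F f.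
Hypothesis mw : forall j, (0 < j)%N -> G_measurable (F j.-1) (w j).
Hypothesis w_ge0 : forall j x, (0 < j)%N -> 0 <= w j x.
Hypothesis incr_le :
  forall j, (0 < j)%N -> {ae P, forall x, `|f j x - f j.-1 x| <= w j x}.
Hypothesis sum_le :
  (ess_sup P (fun x => \sum_(1 <= j <oo) ((w j x) ^+ 2)%:E) <= b%:E)%E.
Hypothesis b_gt0 : 0 < b.

Let sF j : sigma_algebra setT (F j). Proof. by case: filtF. Qed.

Let FT j : F j `<=` measurable. Proof. by case: filtF. Qed.

Let F_le i j : (i <= j)%N -> F i `<=` F j. Proof. by case: filtF => _ _ + _; exact. Qed.

Let S j := g_sigma_algebraType (F j).

Let FS j A : F j A = (measurable : set (set (S j))) A.
Proof. by rewrite (measurable_g_measurableTypeE (sF j)). Qed.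

Let mf i j h : (i <= j)%N -> measurable_fun [set: S j] (fun x : S j => ip (f i x) h).
Proof.
move=> ij; apply/G_measurableP => // B mB; apply: (F_le ij).
by case: martf => _ + _; exact.
Qed.

(* Truncating the weights at [sqrt b] changes them on a null set only and makes
   them bounded everywhere. *)
Definition truncated_weight j x : R := Num.min (w j x) (Num.sqrt b).
Local Notation v := truncated_weight.

Definition displacement j x : V := f j x - f 0%N x.
Local Notation g := displacement.

Definition discount (l : R) j x : R :=
  expR (- \sum_(1 <= i < j.+1) ((l * v i x) ^+ 2 / 2)).

(** The event that no exit has occurred up to time j. Integrating over it takes the place of a
    stopping time. *)
Definition inside (rho : R) j : set T :=
  [set x | forall i, (i <= j)%N -> `|g i x| < rho].

Let mg i j h : (i <= j)%N -> measurable_fun [set: S j] (fun x : S j => ip (g i x) h).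
Proof.
move=> ij; under eq_fun do rewrite (ipBl ipP).
by apply: measurable_funB; exact: mf.
Qed.

Let mng i j : (i <= j)%N -> measurable_fun [set: S j] (fun x : S j => `|g i x|).
Proof. by move=> ij; apply: (measurable_norm_weak ipP sepV) => h; exact: mg. Qed.

(** Predictability gains one index: [v j.+1] is already measurable for [F j]. *)
Let mv i j : (0 < i)%N -> (i <= j.+1)%N -> measurable_fun [set: S j] (v i : S j -> R).
Proof.
move=> i0 ij; apply: measurable_minr => //; apply/G_measurableP => // B mB.
apply: (@F_le i.-1); last exact: mw.
by rewrite -ltnS prednK.
Qed.

Let mdisc l j : measurable_fun [set: S j] (discount l j : S j -> R).
Proof.
apply: measurableT_comp => //; apply: measurable_funN.
under eq_fun do rewrite big_nat.
have h i : measurable_fun [set: S j] (fun x : S j =>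
    if (0 < i < j.+1)%N then (l * v i x) ^+ 2 / 2 else 0).
  have [/andP[i0 ij]|_] := boolP (0 < i < j.+1)%N; last exact: measurable_cst.
  apply: measurable_funM => //; apply: measurable_funX.
  by apply: measurable_funM => //; apply: mv => //; exact: ltnW.
under eq_fun do rewrite big_mkcond /=.
exact: measurable_sum.
Qed.

Let v_ge0 j x : (0 < j)%N -> 0 <= v j x.
Proof. by move=> j0; rewrite le_min w_ge0//= sqrtr_ge0. Qed.

Let disc01 l j x : 0 <= discount l j x <= 1.
Proof.
rewrite expR_ge0/= -expR0 ler_expR oppr_le0 sumr_ge0// => i _.
by rewrite divr_ge0// sqr_ge0.
Qed.

Let ae_sum : {ae P, forall x n, \sum_(1 <= j < n) (w j x) ^+ 2 <= b}.
Proof.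
move/ess_supP : sum_le; apply: filterS => x h n.
rewrite -lee_fin -sumEFin; apply: le_trans h.
by apply: nneseries_lim_ge => i _ _; rewrite lee_fin sqr_ge0.
Qed.

Let ae_sumv : {ae P, forall x n, \sum_(1 <= j < n) (v j x) ^+ 2 <= b}.
Proof.
apply: filterS ae_sum => x h n; apply: le_trans (h n).
rewrite big_nat [leRHS]big_nat; apply: ler_sum => i /andP[i0 _].
by rewrite lerXn2r// ?nnegrE ?v_ge0 ?w_ge0// ge_min lexx.
Qed.

(** Truncation keeps the increment bound: the square of [w j.+1] is one term of a sum that is almost
    surely at most b, so [w j.+1] is at most sqrt b. *)
Let ae_incr j : {ae P, forall x, `|f j.+1 x - f j x| <= v j.+1 x}.
Proof.
apply: filterS2 ae_sum (@incr_le j.+1 isT) => x h h'.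
rewrite le_min h'/= (le_trans h')//.
rewrite -[leLHS](ger0_norm (w_ge0 _ _))// -sqrtr_sqr ler_wsqrtr//.
have := h j.+2; rewrite big_nat_recr//=; apply: le_trans.
by rewrite lerDr sumr_ge0// => i _; exact: sqr_ge0.
Qed.

Let F_inside rho j : F j (inside rho j).
Proof.
rewrite FS (_ : inside rho j =
    \bigcap_(i in [set i | (i <= j)%N]) [set x | `|g i x| < rho]) //.
apply: bigcap_measurable; first by exists 0%N.
move=> i /= ij; rewrite (_ : mkset _ =
  (fun x : S j => `|g i x|) @^-1` `]-oo, rho[%classic).
  by rewrite -[X in measurable X]setTI; exact: mng.
by apply/seteqP; split=> t /=; rewrite in_itv.
Qed.

Lemma measurable_inside rho j : measurable (inside rho j).
Proof. exact: FT (F_inside rho j). Qed.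

Let insideS rho j : inside rho j.+1 `<=` inside rho j.
Proof. by move=> x h i ij; apply: h; exact: leqW. Qed.

Let integrable_ipf j h : P.-integrable setT (fun x => (ip (f j x) h)%:E).
Proof.
apply: (@le_integrable _ _ _ P setT measurableT _ (fun t => `|h|%:E * `|f j t|%:E)%E).
- apply/measurable_EFinP; apply: sub_sigma_measurable_fun (@FT j) _.
  by apply/G_measurableP => //; exact: mf.
- move=> t _; rewrite -EFinM lee_fin [leRHS]ger0_norm// mulrC.
  exact: ip_cauchy_schwarz.
- by apply: integrableZl => //; case: martf.
Qed.

Lemma inside_step (l rho : R) j : 0 <= l ->
  (\int[P]_(x in inside rho j)
     (coshR (l * `|g j.+1 x|) * discount l j.+1 x)%:E <=
   \int[P]_(x in inside rho j) (coshR (l * `|g j x|) * discount l j x)%:E)%E.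
Proof.
move=> l0; pose Y x := f j.+1 x - f j x.
have mY h : measurable_fun setT (fun x => ip (Y x) h).
  apply: sub_sigma_measurable_fun (@FT j.+1) _; apply/G_measurableP => //.
  under eq_fun do rewrite (ipBl ipP).
  by apply: measurable_funB; exact: mf.
have iY : P.-integrable setT (fun x => `|Y x|%:E).
  apply: (@le_integrable _ _ _ P setT measurableT _
    (fun t => `|f j.+1 t|%:E + `|f j t|%:E)%E).
  - by apply/measurable_EFinP; exact: (measurable_norm_weak ipP sepV).
  - by move=> t _; rewrite -EFinD lee_fin normr_id [leRHS]ger0_norm// ler_normB.
  - by apply: integrableD => //; case: martf.
have Y0 B h : F j B -> (\int[P]_(t in B) (ip (Y t) h)%:E = 0)%E.
  move=> FB; have mB : measurable B by exact: FT FB.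
  under eq_integral do rewrite (ipBl ipP) EFinB.
  rewrite integralB_EFin//; try by apply: integrableS (integrable_ipf _ _).
  case: martf => _ _ /(_ j j.+1 (leqnSn j) B FB h) ->.
  by rewrite subee// integrable_fin_num//; apply: integrableS (integrable_ipf _ _).
(* Splits off the last discount factor, to match the form of the one-step estimate. *)
have -> : (\int[P]_(x in inside rho j)
     (coshR (l * `|g j.+1 x|) * discount l j.+1 x)%:E =
    \int[P]_(x in inside rho j) (coshR (l * `|g j x + Y x|) *
      (discount l j x * expR (- ((l * v j.+1 x) ^+ 2 / 2))))%:E)%E.
  apply: eq_integral => x _; rewrite /discount big_nat_recr//= opprD expRD.
  by rewrite /Y /displacement [f j x - _ + _]addrC subrKA.
apply: (@integral_coshR_step _ _ _ ipP sepV _ _ P (F j) _ _ _ _ _ _ rho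
  (Num.sqrt b)) => //.
- by move=> h; apply/G_measurableP => //; exact: mg.
- by move=> t /(_ j (leqnn j))/ltW.
- exact/G_measurableP.
- by apply/G_measurableP => //; exact: mv.
- by move=> t; rewrite v_ge0//= ge_min lexx orbT.
- exact: ae_incr.
Qed.

(** An almost sure lower bound for the discounted cosh at the first exit, where the norm is at least
    rho and the squared weights sum to at most b. *)
Let threshold (l rho : R) := coshR (l * rho) * expR (- (l ^+ 2 * b / 2)).

(** Optional stopping by induction: paths that have left are charged the constant [threshold], the
    others their current value. At time 0 all paths are inside, with value 1. *)
Lemma inside_energy (l rho : R) j : 0 <= l -> 0 < rho ->
  ((threshold l rho)%:E * P (~` inside rho j) +
   \int[P]_(x in inside rho j) (coshR (l * `|g j x|) * discount l j x)%:E <= 1)%E.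
Proof.
move=> l0 rho0; elim: j => [|j ih].
  have -> : inside rho 0 = setT.
    apply/seteqP; split=> // x _ i; rewrite leqn0 => /eqP ->.
    by rewrite /displacement subrr normr0.
  rewrite setCT measure0 mule0 add0e.
  under eq_integral => x _ do
    rewrite /displacement subrr normr0 mulr0 coshR0 mul1r /discount big_geq// oppr0 expR0.
  by rewrite integral_cst// mul1e; exact: probability_le1.
apply: le_trans ih.
set Z := fun x => (coshR (l * `|g j.+1 x|) * discount l j.+1 x)%:E.
have Z0 x : (0 <= Z x)%E.
  by rewrite lee_fin mulr_ge0 ?(ltW (coshR_gt0 _))//; have /andP[] := disc01 l j.+1 x.
have mZ : measurable_fun setT Z.
  apply/measurable_EFinP; apply: sub_sigma_measurable_fun (@FT j.+1) _.
  apply/G_measurableP => //; apply: measurable_funM => //.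
  apply: measurableT_comp; first exact: measurable_coshR.
  by apply: measurable_funM => //; exact: mng.
have mI := measurable_inside rho.
(* The paths whose first exit is at time j + 1; they move from the integral to the probability
   term. *)
pose B := inside rho j `\` inside rho j.+1.
have mB : measurable B by exact: measurableD.
have EI : inside rho j = inside rho j.+1 `|` B.
  by rewrite /B setDUK//; exact: insideS.
have EC : ~` inside rho j.+1 = ~` inside rho j `|` B.
  rewrite /B setDE; apply/seteqP; split=> x.
    by move=> hx; have [?|?] := pselect (inside rho j x); [right|left].
  by move=> [hx /insideS//|[]].
have := inside_step rho j l0; rewrite -/Z => hs.
rewrite EC measureU//; last 2 first.
- exact: measurableC.
- by rewrite /B setDE setIA setICl set0I.
rewrite ge0_muleDr ?measure_ge0// -addeA leeD2l//; apply: le_trans hs.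
rewrite [in leRHS]EI ge0_integral_setU//; last 3 first.
- exact: measurable_funTS mZ.
- by move=> x _; exact: Z0.
- by apply/disj_setPS => x [? []].
rewrite -/Z addeC leeD2l// -integral_cst//; apply: ae_ge0_le_integral => //.
- by move=> x _; rewrite lee_fin mulr_ge0 ?expR_ge0// ltW// coshR_gt0.
- by move=> x _; exact: Z0.
- exact: measurable_funTS mZ.
apply: filterS ae_sumv => x hx [xj xj1]; rewrite lee_fin.
have gr : rho <= `|g j.+1 x|.
  rewrite leNgt; apply/negP => h; apply: xj1 => i.
  rewrite leq_eqVlt => /orP[/eqP -> //|]; rewrite ltnS => ij; exact: xj.
rewrite ler_pM ?expR_ge0 ?(ltW (coshR_gt0 _))//.
  by rewrite coshR_le_sqr// lerXn2r// ?nnegrE ?mulr_ge0 ?(ltW rho0)// ler_wpM2l.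
rewrite ler_expR lerN2.
under eq_bigr do rewrite exprMn -mulrA.
by rewrite -mulr_sumr -mulr_suml -mulrA ler_wpM2l ?sqr_ge0// ler_wpM2r.
Qed.

Lemma prob_inside_le (rho : R) j : 0 < rho ->
  (P (~` inside rho j) <= (2 * expR (- (rho ^+ 2 / (2 * b))))%:E)%E.
Proof.
(* This l minimizes l^2 b / 2 - l rho, with minimum - rho^2 / (2 b). *)
move=> rho0; pose l := rho / b.
have l0 : 0 <= l by rewrite divr_ge0// ltW.
have mI := measurable_inside rho j.
have t0 : 0 < threshold l rho by rewrite mulr_gt0 ?coshR_gt0 ?expR_gt0.
have h : ((threshold l rho)%:E * P (~` inside rho j) <= 1)%E.
  apply: le_trans (inside_energy j l0 rho0); rewrite leeDl//.
  apply: integral_ge0 => x _; rewrite lee_fin mulr_ge0 ?(ltW (coshR_gt0 _))//.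
  by have /andP[] := disc01 l j x.
have fP := fin_num_measure P (~` inside rho j) (measurableC mI).
rewrite -(fineK fP) -EFinM lee_fin in h *.
rewrite -ler_pdivlMl// mulr1 in h; apply: le_trans h _.
rewrite -[leRHS]invrK lef_pV2; last 2 first.
- by rewrite posrE.
- by rewrite posrE invr_gt0 mulr_gt0 ?expR_gt0.
rewrite invfM -expRN opprK.
(* Bounding cosh below by half an exponential produces the factor 2 of the final estimate. *)
apply: (@le_trans _ _ (expR (l * rho) / 2 * expR (- (l ^+ 2 * b / 2)))); last first.
  by rewrite ler_wpM2r ?expR_ge0// coshR_ge_expR.
rewrite [leRHS]mulrAC -expRD [leRHS]mulrC ler_wpM2l// ler_expR /l.
rewrite le_eqVlt; apply/orP; left; apply/eqP; field.
by rewrite gt_eqF.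
Qed.

(** The exit events increase with time and the bound does not depend on j, so continuity of the
    measure from below applies. *)
Lemma prob_displacement_le (rho : R) : 0 < rho ->
  (P (\bigcup_j ~` inside rho j) <= (2 * expR (- (rho ^+ 2 / (2 * b))))%:E)%E.
Proof.
move=> rho0.
have mI k : measurable (~` inside rho k).
  exact: measurableC (measurable_inside rho k).
have nI : nondecreasing_seq (fun j => ~` inside rho j).
  by apply/nondecreasing_seqP => n; apply/subsetPset/subsetC; exact: insideS.
apply: (cvge_to_le (nondecreasing_cvg_mu mI (bigcupT_measurable _ mI) nI)).
by apply: nearW => j; exact: prob_inside_le.
Qed.

Lemma measurable_displacement j : measurable_fun setT (fun x => `|g j x|).
Proof.
apply: sub_sigma_measurable_fun (@FT j) _.
by apply/G_measurableP => //; exact: mng.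
Qed.

End MaximalInequality.

(** * The maximal inequality, by passage from levels below [r] to [r] *)

Theorem theorem3p1 (R : realType) (V : completeNormedModType R)
  (ip : V -> V -> R) (d : measure_display) (T : measurableType d)
  (P : probability T R) (F : nat -> set (set T))
  (f : nat -> T -> V) (w : nat -> T -> R) (b r : R) :
  is_inner_product ip ->
  @separable_space R V ->
  filtration F ->
  martingale ip P F f ->
  (forall j, (0 < j)%N -> G_measurable (F j.-1) (w j)) ->
  (forall j x, (0 < j)%N -> 0 <= w j x) ->
  (forall j, (0 < j)%N -> {ae P, forall x, `|f j x - f j.-1 x| <= w j x}) ->
  (ess_sup P (fun x => \sum_(1 <= j <oo) ((w j x) ^+ 2)%:E) <= b%:E)%E ->
  0 < r ->
  (P [set x | (r%:E <= ereal_sup (range (fun j => (`|f j x - f 0%N x|)%:E)))%E]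
    <= (2 * expR (- (r ^+ 2 / (2 * b))))%:E)%E.
Proof.
move=> ipP sepV filtF martf mw w0 incr_le sum_le r0; set S := mkset _.
have mS : measurable S.
  pose u j x := (`|displacement f j x|)%:E.
  have mu : measurable_fun setT (fun x => esups (u ^~ x) 0%N).
    apply: measurable_fun_esups => j; apply/measurable_EFinP.
    exact: (measurable_displacement ipP sepV filtF martf).
  rewrite (_ : S = setT `&`
      (fun x => esups (u ^~ x) 0%N) @^-1` `[r%:E, +oo%E]%classic).
    by apply: mu => //; exact: emeasurable_itv.
  rewrite setTI; apply/seteqP; split=> x; rewrite /S /= in_itv/= leey andbT;
    by rewrite /esups /sdrop/= (_ : mkset _ = setT)//; apply/seteqP; split.
have [b0|b0] := leP b 0.
  (* Here [r ^+ 2 / (2 * b) <= 0], also for [b = 0], so the bound is at least 2. *)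
  rewrite (le_trans (probability_le1 _ mS))// lee_fin.
  have : 1 <= expR (- (r ^+ 2 / (2 * b))).
    by rewrite -expR0 ler_expR oppr_ge0 mulr_ge0_le0 ?sqr_ge0// invr_le0 pmulr_rle0.
  by lra.
(* The supremum may equal r without being attained; a level strictly below r is exceeded at some
   finite time. *)
have key rho : 0 < rho -> rho < r ->
    (P S <= (2 * expR (- (rho ^+ 2 / (2 * b))))%:E)%E.
  move=> rho0 rhor.
  apply: le_trans (prob_displacement_le ipP sepV filtF martf mw w0 incr_le sum_le b0 rho0).
  apply: le_measure; rewrite ?inE//; first apply: bigcupT_measurable => j.
    by apply: measurableC; exact: (measurable_inside ipP sepV filtF martf).
  move=> x; rewrite /S /= => /(lt_le_trans _) h.
  have /ereal_sup_gt[_ [j _ <-]] := h rho%:E ltac:(by rewrite lte_fin).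
  rewrite lte_fin => hj; exists j => //= /(_ j (leqnn j)).
  by rewrite ltNge ltW.
have fP := fin_num_measure P S mS.
rewrite -(fineK fP) lee_fin.
(* The bound is continuous in the level, so letting rho increase to r loses nothing. *)
have c : 2 * expR (- (rho ^+ 2 / (2 * b))) @[rho --> r^'-] -->
    2 * expR (- (r ^+ 2 / (2 * b))).
  apply: cvg_at_left_filter; apply: cvgM; first exact: cvg_cst.
  apply: continuous_cvg; first exact: continuous_expR.
  apply: cvgN; apply: cvgM; last exact: cvg_cst.
  exact: exprn_continuous.
apply: (cvgr_to_ge c); near=> rho.
by rewrite -lee_fin fineK//; apply: key; near: rho;
  [exact: nbhs_left_gt|exact: nbhs_left_lt].
Unshelve. all: by end_near. Qed.
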